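(* Let $0<\alpha<1$ be a fixed constant. For $N=2^n$ put $K=N^{\alpha}$, and let $AV(K)$ be a random $N\times N$ Boolean matrix whose entries are independent, each equal to $1$ with probability $K/N$ and $0$ otherwise. Let $S$ be the set of oracles $f:\{0,1\}^n\to\{0,1\}$ given by the rows of $AV(K)$. Then the query complexity of $AV(K)$ is $\Theta(\sqrt{N/K})$ with high probability; that is, there exist constants $c,C>0$ depending only on $\alpha$ such that the probability (over the random matrix) that $$c\sqrt{N/K}\le Q(S)\le C\sqrt{N/K}$$ tends to $1$ as $N\to\infty$, where $Q(S)$ is the bounded-error quantum query complexity of identifying the input oracle from $S$.
   Context: Let $N=2^n$. An oracle is a Boolean function $f:\{0,1\}^n\to\{0,1\}$, and inputs are identified with integers $0,\dots,N-1$ via binary representation. In an $N\times N$ Boolean matrix each row $i$ represents the oracle $f_i$ whose value $f_i(j)$ is the entry in row $i$, column $j$. The oracle identification problem (OIP) for a set $S$ of oracles: the set $S$ is completely known, an unknown $f\in S$ (the input oracle) is given as a black box, and the task is to determine which element of $S$ it is. A quantum algorithm with $t$ queries is a sequence $U_0,O_f,U_1,O_f,\dots,O_f,U_t$ applied to a fixed initial state (with arbitrary finite workspace), followed by a measurement producing the output, where the $U_j$ are arbitrary unitaries independent of $f$ (they may depend on $S$) and $O_f$ maps $|x\rangle|b\rangle$ to $(-1)^{b\cdot f(x)}|x\rangle|b\rangle$ for $x\in\{0,1\}^n$, $b\in\{0,1\}$ (identity on the rest of the workspace). It solves the OIP for $S$ with bounded error if for every $f\in S$, when run with $O_f$, it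 outputs $f$ with probability at least $2/3$. $Q(S)$ is the minimum $t$ for which such an algorithm exists. *)

(* Defs.v *)
From mathcomp Require Import all_boot all_order all_algebra.
From mathcomp Require Import spectral complex.
From mathcomp Require Import all_classical all_reals all_analysis.
Set Implicit Arguments.
Unset Strict Implicit.
Unset Printing Implicit Defensive.
Import Order.TTheory GRing.Theory Num.Theory.
Local Open Scope ring_scope.
Local Open Scope complex_scope.
Local Open Scope sesquilinear_scope.

(* Bit strings in {0,1}^n are identified with the integers 0, ..., 2^n - 1. *)
Definition input (n : nat) := 'I_(2 ^ n)%N.
Definition oracle (n : nat) := {ffun input n -> bool}.

(* Computational basis |x>|b>|z>, with a workspace of dimension w. *)
Definition qbasis (n w : nat) : finType := (input n * bool * 'I_w)%type.
Definition qdim (n w : nat) : nat := #|qbasis n w|.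

(* The query operator O_f : |x>|b>|z> |-> (-1)^(b f(x)) |x>|b>|z>. *)
Definition oracle_mx (R : realType) (n w : nat) (f : oracle n) :
    'M[R[i]]_(qdim n w) :=
  diag_mx (\row_i let: (x, b, _) := (enum_val i : qbasis n w) in
                  (-1) ^+ (b && f x)).

Definition sqnorm (R : realType) (d : nat) (v : 'cV[R[i]]_d) : R[i] :=
  \sum_i `|v i 0| ^+ 2.

(* An algorithm making t queries. Only the unitaries of index at most t are
   used. The final measurement is an arbitrary quantum measurement whose
   outcomes are oracles, given by measurement operators M_g satisfying the
   completeness relation; outcome g has probability ||M_g v||^2. *)
Record qalgorithm (R : realType) (n t : nat) := QAlgorithm {
  qwork : nat;
  qinit : 'cV[R[i]]_(qdim n qwork);
  qunitary : nat -> 'M[R[i]]_(qdim n qwork);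
  qmeas : oracle n -> 'M[R[i]]_(qdim n qwork);
  qinit_unit : sqnorm qinit = 1;
  qunitaryP : forall j, (j <= t)%N -> qunitary j \is unitarymx;
  qmeas_complete : \sum_g (qmeas g)^t* *m qmeas g = 1%:M
}.

Fixpoint qstate (R : realType) (n t : nat) (A : qalgorithm R n t)
    (f : oracle n) (k : nat) : 'cV[R[i]]_(qdim n (qwork A)) :=
  if k is k'.+1
  then qunitary A k *m (oracle_mx R (qwork A) f *m qstate A f k')
  else qunitary A 0 *m qinit A.

(* The complex number below is real and lies in [0, 1]. *)
Definition output_prob (R : realType) (n t : nat) (A : qalgorithm R n t)
    (f g : oracle n) : R[i] :=
  sqnorm (qmeas A g *m qstate A f t).

Definition solves_OIP (R : realType) (n t : nat) (A : qalgorithm R n t)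
    (S : {set oracle n}) : Prop :=
  forall f, f \in S -> 2 / 3 <= output_prob A f f.

(* q = Q(S) *)
Definition is_query_complexity (R : realType) (n : nat) (S : {set oracle n})
    (q : nat) : Prop :=
  (exists A : qalgorithm R n q, solves_OIP A S) /\
  (forall t, (exists A : qalgorithm R n t, solves_OIP A S) -> (q <= t)%N).

Definition row_oracles (n : nat) (M : 'M[bool]_(2 ^ n)%N) : {set oracle n} :=
  [set [ffun j => M i j] | i : 'I_(2 ^ n)%N].

(* Probability of the event E when the entries of an N x N Boolean matrix are
   independent, each equal to 1 with probability K / N. *)
Definition AV_prob (R : realType) (N : nat) (K : R) (E : 'M[bool]_N -> Prop) :
    R :=
  \sum_(M : 'M[bool]_N | `[< E M >])
    \prod_i \prod_j (if M i j then K / N%:R else 1 - K / N%:R).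

(* Main.v *)
(** Lower bound: compare the run on f with the run on the zero oracle.  The k-th
    query disturbs the latter by the weight it puts on the ones of f; summed over
    f in S this weight is at most the largest column sum, i.e. O(K), so t queries
    move the N final states by O(t^2 K) in total squared distance, whereas a
    correct algorithm needs this to be of order N.

    Upper bound: run Grover's search a constant number of times, each with
    t = floor(sqrt(N/K)/8) iterations, so that every run yields with constant
    probability a uniformly random one of the unknown f.  Two rows share at most a
    fraction N^-d of their ones, so a wrong row collects h hits among the samples
    with probability O(N^(-d h)), and a union bound over the rows applies as soon
    as d h > 1.

    The row and column sums and the overlaps of a random matrix are controlled by
    exponential moments and a union bound, where X = N^d measures all errors. *)
Require Import Defs.
From mathcomp Require Import all_boot all_order all_algebra.
From mathcomp Require Import spectral complex ring lra.
From mathcomp Require Import all_classical all_reals all_analysis.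
Set Implicit Arguments.
Unset Strict Implicit.
Unset Printing Implicit Defensive.
Import Order.TTheory GRing.Theory Num.Theory.
Import numFieldNormedType.Exports.
Local Open Scope ring_scope.

(** * The hybrid argument *)

Lemma le_of_eq (R : numDomainType) (x y : R) : x = y -> x <= y.
Proof. by move=> ->. Qed.

(** * Squared norms with values in the real field *)

Section RealSquaredNorm.
Local Open Scope complex_scope.
Local Open Scope sesquilinear_scope.
Variable R : realType.

(** The squared modulus as an element of [R] instead of [R[i]], so that all estimates take place in
    an ordered real field. *)
Definition cnormsq (z : R[i]) : R := complex.Re z ^+ 2 + complex.Im z ^+ 2.

Definition vnormsq d (v : 'cV[R[i]]_d) : R := \sum_i cnormsq (v i 0).

Lemma cnormsq_ge0 z : 0 <= cnormsq z.
Proof. by rewrite addr_ge0 ?sqr_ge0. Qed.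

Lemma cnormsq0 : cnormsq 0 = 0.
Proof. by rewrite /cnormsq /= expr0n addr0. Qed.

Lemma sqnormE d (v : 'cV[R[i]]_d) : sqnorm v = (vnormsq v)%:C.
Proof.
rewrite /sqnorm /vnormsq rmorph_sum; apply: eq_bigr => i _.
by rewrite -add_Re2_Im2.
Qed.

Lemma vnormsq_ge0 d (v : 'cV[R[i]]_d) : 0 <= vnormsq v.
Proof. by apply: sumr_ge0 => i _; exact: cnormsq_ge0. Qed.

(** Weighted Young inequality: the gap between the two sides is a nonnegative multiple of a square.
    The free weight [l] is tuned in [hybrid_bound]. *)
Lemma sqr_young (a b l : R) : 0 < l ->
  (a + b) ^+ 2 <= (1 + l) * a ^+ 2 + (1 + l^-1) * b ^+ 2.
Proof.
move=> l0; rewrite -subr_ge0.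
have -> : (1 + l) * a ^+ 2 + (1 + l^-1) * b ^+ 2 - (a + b) ^+ 2
  = l^-1 * (l * a - b) ^+ 2 by field; rewrite gt_eqF.
by rewrite mulr_ge0 ?sqr_ge0// invr_ge0 ltW.
Qed.

Lemma vnormsq_young d (u v : 'cV[R[i]]_d) (l : R) : 0 < l ->
  vnormsq (u + v) <= (1 + l) * vnormsq u + (1 + l^-1) * vnormsq v.
Proof.
move=> l0; rewrite /vnormsq !mulr_sumr -big_split/=; apply: ler_sum => i _.
rewrite mxE /cnormsq !raddfD/=.
have h1 := sqr_young (complex.Re (u i 0)) (complex.Re (v i 0)) l0.
have h2 := sqr_young (complex.Im (u i 0)) (complex.Im (v i 0)) l0.
by apply: le_trans (lerD h1 h2) _; apply: le_of_eq; ring.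
Qed.

Lemma sqnorm_dotmx d (v : 'cV[R[i]]_d) : sqnorm v = (v^t* *m v) 0 0.
Proof.
rewrite mxE; apply: eq_bigr => i _.
by rewrite !mxE normCK mulrC.
Qed.

Lemma vnormsq_unitary d (U : 'M[R[i]]_d) (v : 'cV[R[i]]_d) :
  U \is unitarymx -> vnormsq (U *m v) = vnormsq v.
Proof.
(* [unitarymxP] gives U U^* = 1; for square matrices this can be commuted to U^* U = 1, the product
   that occurs in the norm of U v. *)
move=> /unitarymxP/mulmx1C hU; apply: (@complexI R); rewrite -!sqnormE.
by rewrite !sqnorm_dotmx trmx_mul map_mxM mulmxA -[_ *m U]mulmxA hU mulmx1.
Qed.

(** The sum of the v^* M_g^* M_g v collapses by completeness: outcome probabilities of a unit vector
    add up to 1. *)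
Lemma vnormsq_meas (I : finType) d (M : I -> 'M[R[i]]_d) (v : 'cV[R[i]]_d) :
  \sum_g (M g)^t* *m M g = 1%:M -> \sum_g vnormsq (M g *m v) = vnormsq v.
Proof.
move=> hM; apply: (@complexI R); rewrite rmorph_sum/= -!sqnormE.
under eq_bigr => g _.
  rewrite -sqnormE sqnorm_dotmx trmx_mul map_mxM mulmxA -[_ *m M g]mulmxA.
  over.
by rewrite -summxE -mulmx_suml -mulmx_sumr hM mulmx1 sqnorm_dotmx.
Qed.

End RealSquaredNorm.

(** * Comparison with the zero oracle *)

Section LowerBound.
Local Open Scope complex_scope.
Variables (R : realType) (n t : nat) (A : qalgorithm R n t).

Lemma oracle_mxE w (f : oracle n) (v : 'cV[R[i]]_(qdim n w)) i :
  (oracle_mx R w f *m v) i 0 =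
  (-1) ^+ ((enum_val i : qbasis n w).1.2 && f (enum_val i : qbasis n w).1.1) * v i 0.
Proof. by rewrite mul_diag_mx !mxE; case: (enum_val i) => -[x b] z. Qed.

Lemma cnormsq_signM (s : bool) (z : R[i]) : cnormsq ((-1) ^+ s * z) = cnormsq z.
Proof. by case: z s => a b []; rewrite /cnormsq ?mul1r ?mulN1r//= !sqrrN. Qed.

Lemma vnormsq_oracle w (f : oracle n) (v : 'cV[R[i]]_(qdim n w)) :
  vnormsq (oracle_mx R w f *m v) = vnormsq v.
Proof. by apply: eq_bigr => i _; rewrite oracle_mxE cnormsq_signM. Qed.

Lemma vnormsq_qstate (f : oracle n) k : (k <= t)%N -> vnormsq (qstate A f k) = 1.
Proof.
elim: k => [_|k IH kt] /=.
  rewrite vnormsq_unitary ?qunitaryP//.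
  by apply: (@complexI R); rewrite -sqnormE qinit_unit.
by rewrite vnormsq_unitary ?qunitaryP// vnormsq_oracle IH// ltnW.
Qed.

Definition oracle0 : oracle n := [ffun=> false].

Lemma oracle_mx0 w (v : 'cV[R[i]]_(qdim n w)) : oracle_mx R w oracle0 *m v = v.
Proof.
apply/matrixP => i j; rewrite (ord1 j) oracle_mxE ffunE andbF.
by rewrite expr0 mul1r.
Qed.

(** Measured along the run on the zero oracle, which is the same for all [f]; hence a sum over [f]
    can be exchanged with the sum over basis states. *)
Definition disturbance (f : oracle n) k : R :=
  vnormsq (oracle_mx R (qwork A) f *m qstate A oracle0 k - qstate A oracle0 k).

(* The Young weights 1/k and k telescope, which gives the Cauchy-Schwarz form
   of the hybrid argument without square roots. *)
Lemma hybrid_bound (f : oracle n) k : (k <= t)%N ->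
  vnormsq (qstate A f k - qstate A oracle0 k)
    <= k%:R * \sum_(j < k) disturbance f j.
Proof.
elim: k => [_|k IH kt] /=.
  by rewrite subrr mul0r /vnormsq big1// => i _; rewrite mxE cnormsq0.
rewrite -mulmxBr vnormsq_unitary ?qunitaryP// oracle_mx0.
set Of := oracle_mx R _ f; set u := qstate A f k; set v := qstate A _ k.
have -> : Of *m u - v = Of *m (u - v) + (Of *m v - v).
  by rewrite mulmxBr addrA subrK.
have {}IH : vnormsq (u - v) <= k%:R * \sum_(j < k) disturbance f j by exact/IH/ltnW.
rewrite big_ord_recr/=.
(* The weight 1/k makes no sense for k = 0, where the two runs still coincide. *)
case: k => [|k] in kt u v IH *.
  rewrite big_ord0 add0r mul1r.
  rewrite big_ord0 mulr0 in IH.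
  suff -> : u - v = 0 by rewrite mulmx0 add0r.
  by rewrite /u /v/= subrr.
have kp : 0 < (k.+1%:R : R)^-1 by rewrite invr_gt0 ltr0Sn.
apply: le_trans (vnormsq_young _ _ kp) _; rewrite vnormsq_oracle invrK.
rewrite mulrDr; apply: lerD; last by rewrite nat1r.
have -> : 1 + k.+1%:R^-1 = k.+2%:R / k.+1%:R :> R.
  by rewrite -[k.+2%:R]nat1r mulrDl mul1r mulfV ?pnatr_eq0// addrC.
rewrite -mulrA ler_wpM2l ?ler0n//.
by rewrite ler_pdivrMl ?ltr0Sn.
Qed.

(** A query to [f] negates the amplitude at a basis state with query bit 1 exactly when [f x] holds,
    which costs four times its squared modulus. At most [c] oracles of [S] do so at a given x, and
    the squared moduli sum to 1. *)
Lemma sum_disturbance (S : {set oracle n}) (c : R) k : (k <= t)%N ->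
  (forall x, (#|[set f in S | f x]|)%:R <= c) ->
  \sum_(f in S) disturbance f k <= 4 * c.
Proof.
move=> kt hc; rewrite /disturbance /vnormsq exchange_big/=.
set v := qstate A oracle0 k.
have -> : 4 * c = \sum_i 4 * c * cnormsq (v i 0).
  rewrite -mulr_sumr; have := vnormsq_qstate oracle0 kt.
  by rewrite /vnormsq => ->; rewrite mulr1.
apply: ler_sum => i _; set x := (enum_val i : qbasis n _).1.1.
apply: (@le_trans _ _ (\sum_(f in S) (f x)%:R * (4 * cnormsq (v i 0)))).
  apply: ler_sum => f _; rewrite [X in cnormsq X]mxE oracle_mxE [X in _ + X]mxE -/x.
  have h0 := cnormsq_ge0 (v i 0).
  case: (f x); last by rewrite andbF expr0 mul1r subrr cnormsq0 mul0r.
  rewrite andbT mul1r; case: (_.1.2); last first.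
    by rewrite expr0 mul1r subrr cnormsq0 mulr_ge0.
  rewrite expr1 mulN1r; case: (v i 0) => a b; rewrite /cnormsq/=.
  by apply: le_of_eq; ring.
rewrite -mulr_suml.
have -> : \sum_(f in S) (f x)%:R = (#|[set f in S | f x]|)%:R :> R.
  rewrite -sum1_card natr_sum; under [RHS]eq_bigl => f do rewrite inE.
  rewrite big_mkcondr/=; apply: eq_bigr => f _; by case: (f x).
rewrite mulrCA -mulrA ler_wpM2l// ler_wpM2r//; exact: cnormsq_ge0.
Qed.

(** For each [f], 2/3 is at most twice the probability that the zero run answers [f] plus twice the
    squared distance of the runs. Summed over [S], the first terms give at most 2, being outcomes of
    a single measurement; the second give 2 t (4 c t). *)
Lemma query_lower_bound (S : {set oracle n}) (c : R) :
  (forall x, (#|[set f in S | f x]|)%:R <= c) -> solves_OIP A S ->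
  2 / 3 * #|S|%:R <= 2 + 8 * c * t%:R ^+ 2.
Proof.
move=> hc hA.
have hf f : f \in S -> 2 / 3 <= 2 * vnormsq (qmeas A f *m qstate A oracle0 t)
     + 2 * (t%:R * \sum_(j < t) disturbance f j).
  move=> /hA; rewrite /output_prob sqnormE.
  have -> : (2 / 3 : R[i]) = (2 / 3 : R)%:C by rewrite rmorphM fmorphV !rmorph_nat.
  rewrite lecR => /le_trans; apply.
  rewrite -[qstate A f t](subrK (qstate A oracle0 t)) mulmxDr addrC.
  apply: le_trans (vnormsq_young _ _ ltr01) _.
  rewrite invr1 lerD2l ler_wpM2l//.
  apply: le_trans (hybrid_bound f (leqnn t)).
  (* The component of the difference at outcome [f] is bounded by the sum over all outcomes. *)
  rewrite -(vnormsq_meas (qstate A f t - _) (qmeas_complete A)).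
  by rewrite (bigD1 f)//= lerDl sumr_ge0// => g _; exact: vnormsq_ge0.
have : \sum_(f in S) (2 / 3 : R) <= \sum_(f in S)
    (2 * vnormsq (qmeas A f *m qstate A oracle0 t)
     + 2 * (t%:R * \sum_(j < t) disturbance f j)) by apply: ler_sum => f /hf.
rewrite sumr_const -[X in X <= _]mulr_natr => /le_trans; apply.
rewrite big_split/= -!mulr_sumr; apply: lerD.
  rewrite -[X in _ <= X]mulr1 ler_wpM2l//.
  rewrite -(vnormsq_qstate oracle0 (leqnn t)) -(vnormsq_meas _ (qmeas_complete A)).
  rewrite [X in _ <= X](bigID (mem S))/= lerDl.
  by rewrite sumr_ge0// => g _; exact: vnormsq_ge0.
rewrite exchange_big/=.
have : \sum_(j < t) \sum_(f in S) disturbance f j <= \sum_(j < t) 4 * c.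
  by apply: ler_sum => j _; apply: sum_disturbance => //; exact/ltnW.
rewrite sumr_const card_ord -[X in _ <= X]mulr_natr => h.
apply: (@le_trans _ _ (2 * (t%:R * (4 * c * t%:R)))).
  by rewrite !ler_wpM2l ?ler0n.
by apply: le_of_eq; ring.
Qed.

End LowerBound.

(** * Parallel runs of Grover's search *)

Section RealKernels.
Local Open Scope complex_scope.
Local Open Scope sesquilinear_scope.
Variables (R : realType) (T : finType).

Definition kernel_vec (g : T -> R) : 'cV[R[i]]_#|T| :=
  \col_i (g (enum_val i))%:C.

Definition kernel_mx (k : T -> T -> R) : 'M[R[i]]_#|T| :=
  \matrix_(i, j) (k (enum_val i) (enum_val j))%:C.

Lemma sum_enum_val (V : nmodType) (F : T -> V) :
  \sum_(i < #|T|) F (enum_val i) = \sum_s F s.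
Proof.
rewrite [RHS](reindex_onto enum_val enum_rank) => [|s _]; rewrite ?enum_rankK//.
by apply: eq_bigl => i; rewrite enum_valK eqxx.
Qed.

Lemma kernel_mx_vec k g :
  kernel_mx k *m kernel_vec g = kernel_vec (fun s => \sum_u k s u * g u).
Proof.
apply/matrixP => i j; rewrite (ord1 j) !mxE -sum_enum_val rmorph_sum.
by apply: eq_bigr => u _; rewrite !mxE rmorphM.
Qed.

(** A real symmetric involution is its own adjoint and inverse. Both the diffusion and the register
    swaps are of this kind. *)
Lemma kernel_mx_unitary k : (forall s u, k s u = k u s) ->
  (forall s v, \sum_u k s u * k u v = (s == v)%:R) ->
  kernel_mx k \is unitarymx.
Proof.
move=> ksym kk; apply/unitarymxP/matrixP => i j; rewrite !mxE.
transitivity ((\sum_u k (enum_val i) u * k u (enum_val j))%:C); last first.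
  by rewrite kk (inj_eq enum_val_inj) rmorph_nat.
rewrite -sum_enum_val rmorph_sum; apply: eq_bigr => u _.
by rewrite !mxE rmorphM/= conj_Creal ?complex_real// (ksym (enum_val u)).
Qed.

Lemma vnormsq_kernel (g : T -> R) : vnormsq (kernel_vec g) = \sum_s g s ^+ 2.
Proof.
rewrite -sum_enum_val; apply: eq_bigr => i _.
by rewrite mxE /cnormsq/= expr0n addr0.
Qed.

Lemma perm_kernel_unitary (p : T -> T) : involutive p ->
  kernel_mx (fun s u => (s == p u)%:R) \is unitarymx.
Proof.
move=> pK; apply: kernel_mx_unitary => [s u|s v].
  by rewrite -(inj_eq (inv_inj pK)) pK eq_sym.
rewrite (bigD1 (p v))//= pK eqxx mulr1 big1 ?addr0// => u /negPf ->.
by rewrite mulr0.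
Qed.

End RealKernels.

(** * Grover's iteration as a recurrence for two amplitudes *)

Section GroverAmplitudes.
Variable R : realType.

(* Amplitudes, in units of 1/sqrt N, of an accepted and of a rejected input
   after k Grover iterations, when a fraction p of the inputs is accepted. *)
Fixpoint grover_amp (p : R) (k : nat) : R * R :=
  if k is k'.+1 then
    let: (a, b) := grover_amp p k' in
    (a + 2 * (b - p * (a + b)), b - 2 * p * (a + b))
  else (1, 1).

Lemma grover_amp_norm p k :
  p * (grover_amp p k).1 ^+ 2 + (1 - p) * (grover_amp p k).2 ^+ 2 = 1.
Proof.
elim: k => [|k] /=; first by rewrite !expr1n !mulr1 addrC subrK.
case: (grover_amp p k) => a b /= IH; rewrite -[RHS]IH; ring.
Qed.

(** Replaces the trigonometric closed form. In this range the accepted amplitude gains between 1 and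
    2 per iteration, while the rejected one loses at most 4 p (k + 1); these losses add up to 2 p k
    (k + 1). *)
Lemma grover_amp_bounds p k : 0 <= p -> p * k%:R ^+ 2 <= 16^-1 ->
  [/\ k.+1%:R <= (grover_amp p k).1, (grover_amp p k).1 <= 2 * k%:R + 1,
      1 - 2 * p * k%:R * (k%:R + 1) <= (grover_amp p k).2 &
      (grover_amp p k).2 <= 1].
Proof.
move=> p0; elim: k => [|k IH] hk /=.
  by split; rewrite ?mulr0 ?mul0r ?subr0 ?add0r.
move: IH; case: (grover_amp p k) => a b /= IH.
have k0 : 0 <= k%:R :> R by rewrite ler0n.
move: IH hk; rewrite -[k.+2%:R]natr1 -![k.+1%:R]natr1; move: (k%:R : R) k0 => x x0 IH hk.
(* The products p x and p x^2 are treated as atoms from here on, which makes the remaining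
   inequalities linear. *)
have px0 : 0 <= p * x by rewrite mulr_ge0.
have pxx0 : 0 <= p * x ^+ 2 by rewrite mulr_ge0 ?sqr_ge0.
have {}hk : p * x ^+ 2 + 2 * (p * x) + p <= 16^-1.
  by apply: le_trans hk; apply: le_of_eq; ring.
have [|h1 h2 h3 h4] := IH; first by lra.
have {}h3 : 1 - 2 * (p * x ^+ 2) - 2 * (p * x) <= b.
  by apply: le_trans h3; apply: le_of_eq; ring.
have s0 : 0 <= p * (a + b) by rewrite mulr_ge0//; lra.
have s1 : p * (a + b) <= 2 * (p * x) + 2 * p.
  apply: (@le_trans _ _ (p * (2 * x + 2))); first by rewrite ler_wpM2l//; lra.
  by apply: le_of_eq; ring.
split; [lra | lra | | lra].
apply: (@le_trans _ _ (1 - 2 * (p * x ^+ 2) - 6 * (p * x) - 4 * p)); last by lra.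
by apply: le_of_eq; ring.
Qed.

End GroverAmplitudes.

(** * An algorithm that stores the outcomes of successive Grover runs *)

Section ParallelGrover.
Local Open Scope complex_scope.
Local Open Scope sesquilinear_scope.
Variables (R : realType) (n m t : nat).
Hypothesis t_gt0 : (0 < t)%N.

Let registers : finType := {ffun 'I_m.+1 -> input n}.
Let w := #|registers|.
Let T := qbasis n w.
Let N : R := (2 ^ n)%:R.

Lemma sum_qbasis (F : T -> R) :
  \sum_s F s = \sum_x \sum_b \sum_(z : registers) F (x, b, enum_rank z).
Proof.
rewrite !pair_big/= [RHS](reindex (fun s : T => (s.1, enum_val s.2)))/=.
  by apply: eq_bigr => -[[x b] z] _ /=; rewrite enum_valK.
by exists (fun s => (s.1, enum_rank s.2)) => -[[x b] z] _ /=;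
  rewrite ?enum_valK ?enum_rankK.
Qed.

Let N_neq0 : N != 0.
Proof. by rewrite pnatr_eq0 -lt0n expn_gt0. Qed.

(** Grover's inversion about the mean. *)
Definition diffusion (a : input n -> R) (x : input n) : R :=
  2 / N * (\sum_y a y) - a x.

Definition diffusion_kernel (s u : T) : R :=
  (s.1.2 == u.1.2)%:R * (s.2 == u.2)%:R * (2 / N - (s.1.1 == u.1.1)%:R).

Lemma diffusion_kernelE (F : T -> R) s :
  \sum_u diffusion_kernel s u * F u =
  diffusion (fun x => F (x, s.1.2, s.2)) s.1.1.
Proof.
case: s => -[x b] z; rewrite sum_qbasis /diffusion /diffusion_kernel/=.
transitivity (\sum_y (2 / N - (x == y)%:R) * F (y, b, z)).
  apply: eq_bigr => y _; rewrite (bigD1 b)//= [X in _ + X]big1 ?addr0; last first.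
    by move=> c; rewrite eq_sym => /negPf ->; rewrite big1// => v _; rewrite !mul0r.
  rewrite (bigD1 (enum_val z))//= big1 ?addr0 => [|v]; last first.
    move=> vz; case: (z =P _) => [zv|_]; last by rewrite /= mulr0 !mul0r.
    by move: vz; rewrite zv enum_rankK eqxx.
  by rewrite enum_valK !eqxx !mul1r.
rewrite mulr_sumr; under eq_bigr do rewrite mulrBl; rewrite sumrB; congr (_ - _).
rewrite (bigD1 x)//= eqxx mul1r big1 ?addr0// => y.
by rewrite eq_sym => /negPf ->; rewrite mul0r.
Qed.

Lemma sum_input_const (c : R) : \sum_(x : input n) c = N * c.
Proof. by rewrite sumr_const card_ord mulr_natl. Qed.

(** On the query input the kernel is 2/N minus the identity. Its columns sum to 1, so applying it
    twice gives 2/N - (2/N - identity). *)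
Lemma diffusion_unitary : kernel_mx diffusion_kernel \is unitarymx.
Proof.
apply: kernel_mx_unitary => [[[x b] z] [[y c] v]|[[x b] z] [[y c] v]].
  by rewrite /diffusion_kernel/= !(eq_sym x) !(eq_sym b) !(eq_sym z).
rewrite diffusion_kernelE /diffusion /diffusion_kernel/= -mulr_sumr.
have -> : \sum_i (2 / N - (i == y)%:R) = 1 :> R.
  rewrite sumrB sum_input_const (bigD1 y)//= eqxx big1 => [|i /negPf -> //].
  by rewrite /= addr0 mulrCA divff// mulr1 -natrB.
rewrite !xpair_eqE; case: (b == c); case: (z == v); case: (x == y);
  rewrite ?andbF ?andbT/= ?mulr0 ?mul0r ?mulr1 ?mul1r ?subrr//; ring.
Qed.

Definition swap_register (j : 'I_m.+1) (s : T) : T :=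
  let: (x, b, z) := s in
  (enum_val z j, b, enum_rank [ffun l => if l == j then x else enum_val z l]).

Lemma swap_registerK j : involutive (swap_register j).
Proof.
move=> [[x b] z]; rewrite /swap_register enum_rankK ffunE eqxx.
congr (_, _, _); rewrite -[RHS]enum_valK; congr enum_rank.
by apply/ffunP => l; rewrite !ffunE; case: eqP => [->|].
Qed.

Definition swap_kernel j (s u : T) : R := (s == swap_register j u)%:R.

(** The factor [s.1.2%:R] fixes the query bit at 1, so that every query acts as a phase flip on the
    accepted inputs. *)
Definition product_state (a : input n -> R) (c : 'I_m.+1 -> input n -> R) : T -> R :=
  fun s => s.1.2%:R * a s.1.1 * \prod_l c l ((enum_val s.2 : registers) l).

(** Diffusion, queries and swaps all map product states to product states, so the whole computation
    can be followed factor by factor. *)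
Lemma diffusion_product a c : kernel_mx diffusion_kernel *m
    kernel_vec (product_state a c) = kernel_vec (product_state (diffusion a) c).
Proof.
rewrite kernel_mx_vec; apply/matrixP => i j; rewrite !mxE; congr (_%:C).
rewrite diffusion_kernelE /diffusion /product_state/=.
under eq_bigr do rewrite -mulrA mulrCA.
rewrite -mulr_suml mulrBr mulrBl; congr (_ - _); ring.
Qed.

Lemma oracle_product f a c : oracle_mx R w f *m kernel_vec (product_state a c) =
  kernel_vec (product_state (fun x => (-1) ^+ f x * a x) c).
Proof.
apply/matrixP => i j; rewrite (ord1 j) oracle_mxE !mxE /product_state.
case: (enum_val i) => -[x b] z /=.
have -> (e : bool) : (-1) ^+ e = ((-1) ^+ e)%:C :> R[i].
  by rewrite rmorphXn rmorphN rmorph1.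
by rewrite -rmorphM; congr (_%:C); case: b; rewrite /= ?mul1r ?mul0r ?mulr0// mulrA.
Qed.

Lemma swap_product j a c :
  kernel_mx (swap_kernel j) *m kernel_vec (product_state a c) =
  kernel_vec (product_state (c j) (fun l => if l == j then a else c l)).
Proof.
rewrite kernel_mx_vec; apply/matrixP => i k; rewrite !mxE; congr (_%:C).
rewrite (bigD1 (swap_register j (enum_val i)))//= /swap_kernel swap_registerK eqxx.
rewrite mul1r big1 ?addr0 => [|u hu]; last first.
  case: eqP => [si|]; last by rewrite mul0r.
  by rewrite si swap_registerK eqxx in hu.
case: (enum_val i) => -[x b] z; rewrite /product_state/= enum_rankK.
rewrite (bigD1 j)//= [in RHS](bigD1 j)//= ffunE eqxx.
rewrite -!mulrA; congr (_ * _); rewrite mulrCA; congr (_ * (_ * _)).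
by apply: eq_bigr => l /negPf lj; rewrite ffunE lj.
Qed.

Definition oracle_density (f : oracle n) : R := #|[set x | f x]|%:R / N.

Definition grover_state (f : oracle n) k (x : input n) : R :=
  (Num.sqrt N)^-1 * (if f x then (grover_amp (oracle_density f) k).1
                     else (grover_amp (oracle_density f) k).2).

Lemma sum_oracle (f : oracle n) (a b : R) : \sum_x (if f x then a else b) =
  N * (oracle_density f * a + (1 - oracle_density f) * b).
Proof.
rewrite (eq_bigr (fun x => b + (if f x then a - b else 0))); last first.
  by move=> x _; case: (f x); rewrite ?addr0// addrC subrK.
rewrite big_split/= sum_input_const -big_mkcond/= sumr_const.
have -> : #|[pred x | f x]| = #|[set x | f x]|.
  by apply: eq_card => x; rewrite !inE.
by rewrite -mulr_natl /oracle_density; field.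
Qed.

Lemma grover_stateS (f : oracle n) k x :
  diffusion (fun y => (-1) ^+ f y * grover_state f k y) x = grover_state f k.+1 x.
Proof.
rewrite /diffusion /grover_state/=; case: (grover_amp _ k) => a b /=.
rewrite (eq_bigr (fun y => (Num.sqrt N)^-1 * (if f y then - a else b))); last first.
  by move=> y _; case: (f y); rewrite ?expr1 ?expr0 ?mulN1r ?mul1r ?mulrN.
rewrite -mulr_sumr sum_oracle; set c := (Num.sqrt N)^-1; set p := oracle_density f.
by case: (f x); rewrite /= ?expr1 ?expr0; field.
Qed.

(** Before any iteration the state is uniform. Hence the initial vector can be written with
    [oracle0], without knowledge of the input oracle. *)
Lemma grover_state0 f g x : grover_state f 0 x = grover_state g 0 x.
Proof. by rewrite /grover_state/=; case: (f x); case: (g x). Qed.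

Lemma sqr_grover_state f k x : grover_state f k x ^+ 2 =
  (if f x then (grover_amp (oracle_density f) k).1 ^+ 2
   else (grover_amp (oracle_density f) k).2 ^+ 2) / N.
Proof.
rewrite /grover_state exprMn exprVn sqr_sqrtr ?ler0n// mulrC.
by case: (f x).
Qed.

Lemma sum_sqr_grover_state f k : \sum_x grover_state f k x ^+ 2 = 1.
Proof.
under eq_bigr do rewrite sqr_grover_state.
by rewrite -mulr_suml sum_oracle grover_amp_norm mulr1 divff.
Qed.

(** The squares of product amplitudes form a product weight; the half with query bit 0 vanishes. *)
Lemma vnormsq_product (P : pred registers) a c :
  \sum_(s : T) ((P (enum_val s.2))%:R * product_state a c s) ^+ 2 =
  (\sum_x a x ^+ 2) * \sum_(z | P z) \prod_l c l (z l) ^+ 2.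
Proof.
rewrite sum_qbasis mulr_suml; apply: eq_bigr => x _.
rewrite big_bool/= [X in _ + X]big1 ?addr0 => [|z _]; last first.
  by rewrite /product_state/= !mul0r mulr0 expr0n.
rewrite mulr_sumr [RHS]big_mkcond; apply: eq_bigr => z _.
rewrite /product_state/= enum_rankK mul1r.
by case: (P z); rewrite ?mul0r ?expr0n// mul1r exprMn prodrXl.
Qed.

Lemma sum_prod_sqr_grover (f : 'I_m.+1 -> oracle n) (k : 'I_m.+1 -> nat) :
  \sum_(z : registers) \prod_l grover_state (f l) (k l) (z l) ^+ 2 = 1.
Proof.
rewrite -(bigA_distr_bigA (fun l x => grover_state (f l) (k l) x ^+ 2)).
by rewrite big1// => l _; exact: sum_sqr_grover_state.
Qed.

Variable decode : {ffun 'I_m.+1 -> input n} -> oracle n.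

Definition run_init : 'cV[R[i]]_(qdim n w) :=
  kernel_vec (product_state (grover_state (oracle0 n) 0)
                            (fun _ => grover_state (oracle0 n) 0)).

(** Index 0 does nothing, as the initial vector is already prepared. Run number j, counted from 0,
    ends at index (j + 1) t, whence the predecessor; the swap stores its result and fetches a fresh
    uniform state. *)
Definition run_unitary (k : nat) : 'M[R[i]]_(qdim n w) :=
  if k == 0 then 1%:M
  else if (t %| k)%N
       then kernel_mx (swap_kernel (inord (k %/ t).-1)) *m kernel_mx diffusion_kernel
       else kernel_mx diffusion_kernel.

Definition run_meas (g : oracle n) : 'M[R[i]]_(qdim n w) :=
  diag_mx (\row_i (decode (enum_val (enum_val i : T).2) == g)%:R).

Lemma run_init_unit : sqnorm run_init = 1.
Proof.
rewrite sqnormE vnormsq_kernel.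
have := vnormsq_product predT (grover_state (oracle0 n) 0)
                              (fun _ => grover_state (oracle0 n) 0).
under eq_bigr do rewrite mul1r; move=> ->.
rewrite sum_sqr_grover_state mul1r.
by rewrite (sum_prod_sqr_grover (fun=> oracle0 n) (fun=> 0%N)).
Qed.

Lemma run_unitaryP j : (j <= m.+1 * t)%N -> run_unitary j \is unitarymx.
Proof.
move=> _; rewrite /run_unitary; case: eqP => _.
  by apply/unitarymxP; rewrite trmx1 map_mx1 mulmx1.
case: ifP => _; last exact: diffusion_unitary.
rewrite mul_unitarymx ?diffusion_unitary//.
by apply: perm_kernel_unitary; exact: swap_registerK.
Qed.

Lemma run_meas_complete : \sum_g (run_meas g)^t* *m run_meas g = 1%:M.
Proof.
apply/matrixP => i j; rewrite summxE.
rewrite (eq_bigr (fun g =>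
    (i == j)%:R * (decode (enum_val (enum_val i : T).2) == g)%:R)).
  rewrite -mulr_sumr (bigD1 (decode (enum_val (enum_val i : T).2)))//= eqxx.
  by rewrite big1 ?addr0 ?mulr1 ?mxE// => g; rewrite eq_sym => /negPf ->.
move=> g _; rewrite /run_meas tr_diag_mx map_diag_mx mulmx_diag !mxE.
rewrite rmorph_nat; case: (i == j); case: (_ == g);
  by rewrite /= ?mulr0n ?mulr1n ?mulr0 ?mul0r ?mulr1.
Qed.

Definition run_algorithm : qalgorithm R n (m.+1 * t) :=
  QAlgorithm run_init_unit run_unitaryP run_meas_complete.

(** The state after [j] finished runs and [i] iterations of the next one. *)
Definition run_state f j i : T -> R :=
  product_state (grover_state f i)
    (fun l => grover_state f (if (l < j)%N then t else 0)).

Lemma eq_kernel_vec (F G : T -> R) : F =1 G -> kernel_vec F = kernel_vec G.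
Proof. by move=> FG; apply/matrixP => i j; rewrite !mxE FG. Qed.

Lemma eq_product_state a a' c c' : a =1 a' -> (forall l, c l =1 c' l) ->
  product_state a c =1 product_state a' c'.
Proof.
move=> ha hc s; rewrite /product_state ha; congr (_ * _).
by apply: eq_bigr => l _; exact: hc.
Qed.

Lemma qstate_run f j : (j <= m.+1)%N ->
  qstate run_algorithm f (j * t) = kernel_vec (run_state f j 0).
Proof.
elim: j => [_|j IH jm].
  rewrite mul0n /= /run_unitary eqxx mul1mx; apply: eq_kernel_vec.
  by apply: eq_product_state => [x|l x]; exact: grover_state0.
have step k i : qstate run_algorithm f k = kernel_vec (run_state f j i) ->
    kernel_mx diffusion_kernel *m (oracle_mx R w f *m qstate run_algorithm f k)
    = kernel_vec (run_state f j i.+1).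
  move=> ->; rewrite oracle_product diffusion_product; apply: eq_kernel_vec.
  by apply: eq_product_state => // x; exact: grover_stateS.
(* The last iteration of a run is kept apart because its unitary also contains the swap. *)
have inner i : (i < t)%N ->
    qstate run_algorithm f (j * t + i) = kernel_vec (run_state f j i).
  elim: i => [_|i IHi it]; first by rewrite addn0 IH// ltnW.
  rewrite -(step _ _ (IHi (ltnW it))) addnS /= /run_unitary/= -addnS.
  by rewrite dvdn_addr ?dvdn_mull// gtnNdvd.
have e : ((j * t + t.-1).+1 = j.+1 * t)%N by rewrite -addnS prednK// mulSn addnC.
have tt : (t.-1 < t)%N by rewrite prednK.
have ue : run_unitary (j * t + t.-1).+1 =
    kernel_mx (swap_kernel (inord j)) *m kernel_mx diffusion_kernel.
  by rewrite /run_unitary e dvdn_mull ?dvdnn// (mulnK j.+1 t_gt0) -e.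
rewrite -e [qstate _ _ _]/= ue -mulmxA (step _ _ (inner _ tt)).
rewrite prednK// swap_product; apply: eq_kernel_vec; apply: eq_product_state.
  by rewrite inordK// ltnn.
move=> l x; rewrite -val_eqE/= inordK// ltnS [(l <= j)%N]leq_eqVlt.
by case: (nat_of_ord l == j).
Qed.

(** After the last swap the query input is back in the uniform state and contributes a factor 1; the
    registers hold independent samples, each distributed by the squared amplitudes after [t]
    iterations. *)
Lemma output_prob_run f : output_prob run_algorithm f f =
  (\sum_(z | decode z == f) \prod_l grover_state f t (z l) ^+ 2)%:C.
Proof.
rewrite /output_prob qstate_run// sqnormE; congr (_%:C).
transitivity (vnormsq (kernel_vec (fun s : T =>
    (decode (enum_val s.2) == f)%:R * run_state f m.+1 0 s))).
  congr vnormsq; apply/matrixP => i j; rewrite mul_diag_mx !mxE.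
  by case: (decode _ == f); rewrite /= ?mul1r ?mul0r.
rewrite vnormsq_kernel (vnormsq_product (fun z => decode z == f)).
rewrite sum_sqr_grover_state mul1r; apply: eq_bigr => z _; apply: eq_bigr => l _.
by rewrite ltn_ord.
Qed.

End ParallelGrover.

(** * Exponential Markov bounds *)

(** Markov's inequality for a product of functions: the weighted sum of the product factorises over
    the coordinates. *)
Lemma product_markov (R : realType) (I X : finType) (mu g : I -> X -> R)
    (P : pred {ffun I -> X}) (c : R) :
  (forall i x, 0 <= mu i x) -> (forall i x, 0 <= g i x) -> 0 < c ->
  (forall z, P z -> c <= \prod_i g i (z i)) ->
  \sum_(z | P z) \prod_i mu i (z i) <= c^-1 * \prod_i \sum_x mu i x * g i x.
Proof.
move=> mu0 g0 c0 Pc; rewrite ler_pdivlMl// bigA_distr_bigA/= mulr_sumr.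
rewrite [X in _ <= X](bigID P)/=.
apply: (@le_trans _ _ (\sum_(z | P z) \prod_i (mu i (z i) * g i (z i)))).
  apply: ler_sum => z /Pc; rewrite big_split/= mulrC.
  by apply: ler_wpM2l; rewrite prodr_ge0.
by rewrite lerDl sumr_ge0// => z _; rewrite prodr_ge0// => i _; rewrite mulr_ge0.
Qed.

(** * Decoding independent samples by counting hits *)

Section Identification.
Variables (R : realType) (n m : nat) (S : {set oracle n}) (h : nat).

Definition hits (f : oracle n) (z : {ffun 'I_m -> input n}) : nat :=
  #|[set l | f (z l)]|.

(** If [pick] fails, the input oracle itself has fewer than [h] hits, so the default value falls
    under that error event. *)
Definition hit_decode (z : {ffun 'I_m -> input n}) : oracle n :=
  odflt [ffun=> false] [pick g in S | (h <= hits g z)%N].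

Lemma prod_hits (c : R) (f : oracle n) (z : {ffun 'I_m -> input n}) :
  \prod_l (if f (z l) then c else 1) = c ^+ hits f z.
Proof.
rewrite -big_mkcond/= prodr_const; congr (_ ^+ _).
by apply: eq_card => l; rewrite !inE.
Qed.

Variable mu : input n -> R.
Hypothesis mu_ge0 : forall x, 0 <= mu x.
Hypothesis mu_sum1 : \sum_x mu x = 1.

Let sum_mu_if (g : oracle n) (c : R) :
  \sum_x mu x * (if g x then c else 1) = 1 + (c - 1) * \sum_(x | g x) mu x.
Proof.
rewrite -[X in _ = X + _]mu_sum1 mulr_sumr [X in _ = _ + X]big_mkcond -big_split/=.
by apply: eq_bigr => x _; case: (g x); ring.
Qed.

Let sum_mu_ge0 (g : oracle n) : 0 <= \sum_(x | g x) mu x.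
Proof. exact: sumr_ge0. Qed.

Let sum_mu_le1 (g : oracle n) : \sum_(x | g x) mu x <= 1.
Proof. by rewrite -mu_sum1 [X in _ <= X](bigID g)/= lerDl sumr_ge0. Qed.

(** Exponential Markov bound with a factor 1/2 per hit: one sample contributes at most 1 - r/2 on
    average. *)
Lemma few_hits (f : oracle n) (r : R) : r <= \sum_(x | f x) mu x ->
  \sum_(z | (hits f z < h)%N) \prod_l mu (z l) <= 2 ^+ h * (1 - r / 2) ^+ m.
Proof.
move=> rf; have c0 : (0 : R) < 2^-1 ^+ h by rewrite exprn_gt0.
apply: (le_trans (product_markov (mu := fun=> mu)
  (g := fun _ x => if f x then 2^-1 else 1) _ _ c0 _)).
- by [].
- by move=> _ x; case: (f x); rewrite ?ler01// invr_ge0.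
- move=> z hz; rewrite prod_hits ler_wiXn2l ?invr_ge0 ?invf_le1 ?ler1n//; exact: ltnW.
rewrite exprVn invrK ler_wpM2l ?exprn_ge0// prodr_const card_ord sum_mu_if.
have ? := sum_mu_le1 f.
by rewrite lerXn2r ?nnegrE; lra.
Qed.

(** Exponential Markov bound with a factor 1/q per hit: one sample contributes at most 1 + (1/q - 1)
    q <= 2 on average. *)
Lemma many_hits (g : oracle n) (q : R) : 0 < q -> q <= 1 ->
  \sum_(x | g x) mu x <= q ->
  \sum_(z | (h <= hits g z)%N) \prod_l mu (z l) <= q ^+ h * 2 ^+ m.
Proof.
move=> q0 q1 gq; have c0 : 0 < q^-1 ^+ h by rewrite exprn_gt0// invr_gt0.
have q1' : 1 <= q^-1 by rewrite invf_ge1.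
apply: (le_trans (product_markov (mu := fun=> mu)
  (g := fun _ x => if g x then q^-1 else 1) _ _ c0 _)).
- by [].
- by move=> _ x; case: (g x); rewrite ?ler01// invr_ge0 ltW.
- by move=> z hz; rewrite prod_hits ler_weXn2l.
rewrite exprVn invrK ler_wpM2l ?exprn_ge0 ?(ltW q0)// prodr_const card_ord sum_mu_if.
have g0 := sum_mu_ge0 g.
have h1 : 0 <= (q^-1 - 1) * \sum_(x | g x) mu x by rewrite mulr_ge0 ?subr_ge0.
have h2 : (q^-1 - 1) * \sum_(x | g x) mu x <= (q^-1 - 1) * q.
  by rewrite ler_wpM2l ?subr_ge0.
have h3 : (q^-1 - 1) * q = 1 - q by rewrite mulrBl mulVf ?gt_eqF// mul1r.
by rewrite lerXn2r ?nnegrE//; lra.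
Qed.

(** A wrong answer requires that [f] has fewer than [h] hits or that another member of [S] has at
    least [h]; the union bound is carried out pointwise in the sample [z]. *)
Lemma hit_decode_success (f : oracle n) (r q : R) : f \in S ->
  0 < q -> q <= 1 -> r <= \sum_(x | f x) mu x ->
  (forall g, g \in S -> g != f -> \sum_(x | g x) mu x <= q) ->
  1 - (2 ^+ h * (1 - r / 2) ^+ m + #|S|%:R * (q ^+ h * 2 ^+ m)) <=
    \sum_(z | hit_decode z == f) \prod_l mu (z l).
Proof.
move=> fS q0 q1 rf gq.
have p0 (z : {ffun 'I_m -> input n}) : 0 <= \prod_l mu (z l) by rewrite prodr_ge0.
have total : \sum_(z : {ffun 'I_m -> input n}) \prod_l mu (z l) = 1.
  by rewrite -(bigA_distr_bigA (fun _ x => mu x))/= big1.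
rewrite lerBlDr -[X in X <= _]total (bigID (fun z => hit_decode z == f))/= lerD2l.
apply: (@le_trans _ _ (\sum_(z | (hits f z < h)%N) \prod_l mu (z l) +
   \sum_(g in S :\ f) \sum_(z | (h <= hits g z)%N) \prod_l mu (z l))); last first.
  apply: lerD; first exact: few_hits.
  apply: (@le_trans _ _ (\sum_(g in S :\ f) q ^+ h * 2 ^+ m)).
    by apply: ler_sum => g; rewrite !inE => /andP[gf gS];
      apply: many_hits => //; exact: gq.
  rewrite sumr_const -[X in X <= _]mulr_natl ler_wpM2r ?mulr_ge0 ?exprn_ge0 ?(ltW q0)//.
  by rewrite ler_nat subset_leq_card// subD1set.
under [X in _ <= _ + X]eq_bigr do rewrite big_mkcond.
rewrite exchange_big/= [X in _ <= X + _]big_mkcond [X in X <= _]big_mkcond -big_split/=.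
apply: ler_sum => z _; set s := \sum_(g in _) _.
have s0 : 0 <= s by apply: sumr_ge0 => g _; case: ifP.
have [zf|] := boolP (hit_decode z == f); first by rewrite addr_ge0//; case: ifP.
rewrite /= /hit_decode; case: ltnP => [_ _|hz]; first by rewrite lerDl.
case: pickP => [g /andP[gS gz] gf|/(_ f)]; last by rewrite fS hz.
rewrite add0r /s (bigD1 g) ?inE ?gS ?andbT//= gz lerDl.
by apply: sumr_ge0 => g' _; case: ifP.
Qed.

End Identification.

(** * Row sums, column sums and overlaps of the random matrix *)

Section RandomMatrix.
Variables (R : realType) (N : nat) (K : R).
Hypothesis N_gt0 : (0 < N)%N.
Hypothesis K_ge0 : 0 <= K.
Hypothesis K_leN : K <= N%:R.

Let p := K / N%:R.
Let wt (b : bool) : R := if b then p else 1 - p.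

Let p_ge0 : 0 <= p. Proof. by rewrite divr_ge0. Qed.
Let p_le1 : p <= 1. Proof. by rewrite ler_pdivrMr ?ltr0n// mul1r. Qed.
Let wt_ge0 b : 0 <= wt b. Proof. by case: b; rewrite /wt ?subr_ge0. Qed.

Lemma AV_probE (E : 'M[bool]_N -> Prop) :
  AV_prob K E = \sum_(M : 'M[bool]_N | `[< E M >]) \prod_i \prod_j wt (M i j).
Proof. by []. Qed.

Lemma AV_prob_mono (E F : 'M[bool]_N -> Prop) : (forall M, E M -> F M) ->
  AV_prob K E <= AV_prob K F.
Proof.
move=> EF; rewrite !AV_probE [X in X <= _]big_mkcond [X in _ <= X]big_mkcond/=.
apply: ler_sum => M _; case: asboolP => [/EF/asboolP ->//|_]; case: ifP => // _.
by apply: prodr_ge0 => i _; apply: prodr_ge0.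
Qed.

Lemma AV_prob_union (I : finType) (E : I -> 'M[bool]_N -> Prop) :
  AV_prob K (fun M => exists i, E i M) <= \sum_i AV_prob K (E i).
Proof.
under eq_bigr do rewrite AV_probE big_mkcond.
rewrite exchange_big/= AV_probE big_mkcond/=; apply: ler_sum => M _.
have w0 : 0 <= \prod_i \prod_j wt (M i j).
  by apply: prodr_ge0 => i _; apply: prodr_ge0.
case: asboolP => [[i /asboolP Ei]|_]; last by apply: sumr_ge0 => i _; case: ifP.
by rewrite (bigD1 i)//= Ei lerDl sumr_ge0// => k _; case: ifP.
Qed.

Lemma AV_prob_trmx (E : 'M[bool]_N -> Prop) : AV_prob K (fun M => E M^T) = AV_prob K E.
Proof.
rewrite !AV_probE [RHS](reindex_inj (@trmx_inj _ _ _))/=.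
apply: eq_bigr => M _; rewrite exchange_big/=; apply: eq_bigr => i _.
by apply: eq_bigr => j _; rewrite mxE.
Qed.

Definition column (M : 'M[bool]_N) : {ffun 'I_N -> {ffun 'I_N -> bool}} :=
  [ffun j => [ffun i => M i j]].

(** The columns are independent, so [product_markov] applies with whole columns as coordinates. *)
Lemma AV_markov (g : 'I_N -> {ffun 'I_N -> bool} -> R)
    (E : 'M[bool]_N -> Prop) (c : R) :
  (forall j v, 0 <= g j v) -> 0 < c ->
  (forall M, E M -> c <= \prod_j g j (column M j)) ->
  AV_prob K E <=
    c^-1 * \prod_j \sum_(v : {ffun 'I_N -> bool}) (\prod_i wt (v i)) * g j v.
Proof.
move=> g0 c0 Ec.
pose mat (z : {ffun 'I_N -> {ffun 'I_N -> bool}}) : 'M[bool]_N := \matrix_(i, j) z j i.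
have mat_bij : bijective mat.
  exists column => [z|M]; first by do 2 (apply/ffunP => ?; rewrite !ffunE); rewrite mxE.
  by apply/matrixP => i j; rewrite !mxE !ffunE.
rewrite AV_probE (reindex mat)/=; last exact/onW_bij.
rewrite (eq_bigr (fun z : {ffun 'I_N -> {ffun 'I_N -> bool}} =>
    \prod_j \prod_i wt (z j i))).
  apply: (product_markov
    (mu := fun _ (v : {ffun 'I_N -> bool}) => \prod_i wt (v i))) => //.
    by move=> i v; exact: prodr_ge0.
  move=> z /asboolP/Ec/le_trans; apply; apply: le_of_eq.
  by apply: eq_bigr => j _; congr g; apply/ffunP => i; rewrite !ffunE mxE.
move=> z _; rewrite exchange_big; apply: eq_bigr => j _; apply: eq_bigr => i _.
by rewrite mxE.
Qed.

Lemma AV_probT : AV_prob K (fun _ : 'M[bool]_N => True) = 1.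
Proof.
pose mat (z : {ffun 'I_N -> {ffun 'I_N -> bool}}) : 'M[bool]_N := \matrix_(i, j) z i j.
have mat_bij : bijective mat.
  exists (fun M : 'M[bool]_N =>
    [ffun i => [ffun j => M i j]] : {ffun 'I_N -> {ffun 'I_N -> bool}}) => [z|M].
    by do 2 (apply/ffunP => ?; rewrite !ffunE); rewrite mxE.
  by apply/matrixP => i j; rewrite !mxE !ffunE.
rewrite AV_probE (reindex mat)/=; last exact/onW_bij.
under eq_bigl do rewrite asboolT//.
under eq_bigr do under eq_bigr do under eq_bigr do rewrite mxE.
rewrite -(bigA_distr_bigA (fun _ (v : {ffun 'I_N -> bool}) => \prod_j wt (v j)))/=.
rewrite big1// => i _; rewrite -(bigA_distr_bigA (fun _ b => wt b))/=.
by rewrite big1// => j _; rewrite big_bool/= addrC subrK.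
Qed.

Lemma AV_probC (E : 'M[bool]_N -> Prop) : AV_prob K E = 1 - AV_prob K (fun M => ~ E M).
Proof.
rewrite -AV_probT !AV_probE [X in _ = X - _](bigID (fun M => `[< E M >]))/=.
under [X in _ = X + _ - _]eq_bigl do rewrite asboolT//.
under [X in _ = _ + X - _]eq_bigl do rewrite asboolT// andTb -asbool_neg.
by rewrite addrK.
Qed.

(** A singleton [J] gives a row sum, a pair gives the overlap of two rows, and a singleton with the
    transposed matrix gives a column sum. *)
Definition common_ones (J : {set 'I_N}) (M : 'M[bool]_N) : nat :=
  #|[set j | [forall i in J, M i j]]|.

(** The count is binomial with N trials of success probability p^|J|; the right factor is its
    generating function at [l]. *)
Lemma AV_common_ones_markov (J : {set 'I_N}) (E : 'M[bool]_N -> Prop) (l c : R) :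
  0 < l -> 0 < c -> (forall M, E M -> c <= l ^+ common_ones J M) ->
  AV_prob K E <= c^-1 * (1 + (l - 1) * p ^+ #|J|) ^+ N.
Proof.
move=> l0 c0 Ec.
apply: (le_trans (AV_markov
  (g := fun _ (v : {ffun 'I_N -> bool}) =>
    if [forall i in J, v i] then l else 1) _ c0 _)).
- by move=> _ v; case: ifP => _; rewrite ?ltW.
- move=> M /Ec/le_trans; apply; rewrite -big_mkcond/= prodr_const.
  apply: le_of_eq; congr (_ ^+ _).
  by apply: eq_card => j; rewrite !inE; apply: eq_forallb => i; rewrite !ffunE.
rewrite prodr_const card_ord ler_wpM2l ?invr_ge0 ?(ltW c0)//.
apply: le_of_eq; congr (_ ^+ _).
(* The factor attached to a column is 1 + (l - 1) times an indicator, and the indicator is a product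
   over the rows. *)
transitivity (\sum_(v : {ffun 'I_N -> bool}) \prod_i wt (v i) +
  (l - 1) * \sum_(v : {ffun 'I_N -> bool}) \prod_i (wt (v i) * ((i \in J) ==> v i)%:R)).
  rewrite mulr_sumr -big_split/=; apply: eq_bigr => v _; rewrite big_split/=.
  have -> : \prod_i ((i \in J) ==> v i)%:R = [forall i in J, v i]%:R :> R.
    have [/forallP h|] := boolP [forall i in J, v i].
      by rewrite big1// => i _; rewrite h.
    by rewrite negb_forall => /existsP[i /negPf iv]; rewrite (bigD1 i)//= iv mul0r.
  by case: [forall i in J, v i] => /=; ring.
rewrite -(bigA_distr_bigA (fun _ b => wt b))/=.
rewrite -(bigA_distr_bigA (fun i b => wt b * ((i \in J) ==> b)%:R))/=.
congr (_ + _ * _).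
  by rewrite big1// => j _; rewrite big_bool/= addrC subrK.
rewrite -prodr_const [RHS]big_mkcond/=; apply: eq_bigr => i _; rewrite big_bool/=.
by case: (i \in J) => /=; rewrite ?mulr0 ?addr0 ?mulr1// addrC subrK.
Qed.

Lemma expR1_ge2 : 2 <= expR 1 :> R.
Proof. by have := @expR_ge1Dx R 1; lra. Qed.

Lemma expR1_le4 : expR 1 <= 4 :> R.
Proof.
have h : 2^-1 <= expR (- 2^-1) :> R by have := @expR_ge1Dx R (- 2^-1); lra.
have e0 := @expR_gt0 R 2^-1.
rewrite expRN in h.
have h2 : expR 2^-1 <= 2 :> R.
  by rewrite -[X in _ <= X]invrK -[X in X <= _]invrK lef_pV2 ?posrE ?invr_gt0.
have -> : (1 : R) = 2^-1 + 2^-1 by lra.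
by rewrite expRD; nra.
Qed.

(** The case l = e, with 1 + (e - 1) x <= exp (3 x) because e <= 4. *)
Lemma AV_common_ones_upper (J : {set 'I_N}) (L : R) :
  AV_prob K (fun M => L < (common_ones J M)%:R) <= expR (3 * (N%:R * p ^+ #|J|) - L).
Proof.
have ps : 0 <= p ^+ #|J| by rewrite exprn_ge0.
apply: le_trans (AV_common_ones_markov (J := J) (expR_gt0 1) (expR_gt0 L) _) _.
  by move=> M hM; rewrite -expRM_natl mulr1 ler_expR ltW.
rewrite -expRN [X in _ <= expR X]addrC expRD ler_wpM2l ?expR_ge0//.
rewrite mulrCA expRM_natl; have e2 := expR1_ge2; have e4 := expR1_le4.
have hm : (expR 1 - 1) * p ^+ #|J| <= 3 * p ^+ #|J| by rewrite ler_wpM2r//; lra.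
have h0 : 0 <= (expR 1 - 1) * p ^+ #|J| by rewrite mulr_ge0//; lra.
rewrite lerXn2r ?nnegrE ?expR_ge0//; first lra.
by apply: le_trans (expR_ge1Dx _); lra.
Qed.

(** The case l = 1/e, with 1 + (1/e - 1) x <= exp (- x/2) because e >= 2. *)
Lemma AV_common_ones_lower (J : {set 'I_N}) (L : R) :
  AV_prob K (fun M => (common_ones J M)%:R < L) <= expR (L - N%:R * p ^+ #|J| / 2).
Proof.
have ps : 0 <= p ^+ #|J| by rewrite exprn_ge0.
have ps1 : p ^+ #|J| <= 1 by rewrite exprn_ile1.
apply: le_trans (AV_common_ones_markov (J := J) (expR_gt0 (-1)) (expR_gt0 (- L)) _) _.
  by move=> M hM; rewrite -expRM_natl mulrN1 ler_expR lerN2 ltW.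
rewrite -expRN opprK expRD ler_wpM2l ?expR_ge0//.
have e2 : expR (-1) <= 2^-1 :> R.
  by rewrite expRN lef_pV2 ?posrE ?expR_gt0//; exact: expR1_ge2.
have e0 := @expR_gt0 R (-1).
have -> : - (N%:R * p ^+ #|J| / 2) = N%:R * (- (p ^+ #|J| / 2)) by ring.
rewrite expRM_natl.
have hm : (expR (-1) - 1) * p ^+ #|J| <= (- 2^-1) * p ^+ #|J|.
  by rewrite ler_wpM2r//; lra.
have h0 : (- 1) * p ^+ #|J| <= (expR (-1) - 1) * p ^+ #|J| by rewrite ler_wpM2r//; lra.
rewrite lerXn2r ?nnegrE ?expR_ge0//; first lra.
by apply: le_trans (expR_ge1Dx _); lra.
Qed.

(** The column bound limits the disturbance in the lower bound; the row and overlap bounds make the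
    rows distinct and decodable. *)
Definition balanced (L : R) (M : 'M[bool]_N) : Prop :=
  [/\ forall j, (common_ones [set j] M^T)%:R <= 4 * K,
      forall i, K / 4 <= (common_ones [set i] M)%:R,
      forall i, (common_ones [set i] M)%:R <= 4 * K &
      forall i k, i != k -> (common_ones [set i; k] M)%:R <= L].

(** Union bound over N columns and N rows (exponent 3 K - 4 K), N rows (K/4 - K/2) and N^2 pairs,
    whose mean overlap is K^2/N. *)
Lemma AV_balanced (L : R) :
  1 - (2 * N%:R * expR (- K) + N%:R * expR (- (K / 4))
       + N%:R ^+ 2 * expR (3 * (K ^+ 2 / N%:R) - L)) <= AV_prob K (balanced L).
Proof.
have N0 : N%:R != 0 :> R by rewrite pnatr_eq0 -lt0n.
have Np1 : N%:R * p ^+ 1 = K by rewrite expr1 mulrC divfK.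
have Np2 : N%:R * p ^+ 2 = K ^+ 2 / N%:R by rewrite /p; field.
have up1 i : AV_prob K (fun M => 4 * K < (common_ones [set i] M)%:R) <= expR (- K).
  apply: le_trans (AV_common_ones_upper _ _) _; rewrite cards1 Np1 ler_expR; lra.
rewrite [X in _ <= X]AV_probC lerD2l lerN2.
(* The four ways to fail are indexed by nested booleans, so that [AV_prob_union] handles them as
   well. *)
apply: le_trans (AV_prob_mono (F := fun M => exists s : bool, if s
  then (exists s : bool, if s
    then exists j, 4 * K < (common_ones [set j] M^T)%:R
    else exists i, 4 * K < (common_ones [set i] M)%:R)
  else (exists s : bool, if s
    then exists i, (common_ones [set i] M)%:R < K / 4
    else exists ik : 'I_N * 'I_N,
           ik.1 != ik.2 /\ L < (common_ones [set ik.1; ik.2] M)%:R)) _) _.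
  move=> M; apply: contra_notP => nM; split.
  - by move=> j; rewrite leNgt; apply/negP => h; apply: nM; exists true, true, j.
  - by move=> i; rewrite leNgt; apply/negP => h; apply: nM; exists false, true, i.
  - by move=> i; rewrite leNgt; apply/negP => h; apply: nM; exists true, false, i.
  - move=> i k ik; rewrite leNgt; apply/negP => h; apply: nM.
    by exists false, false, (i, k).
apply: le_trans (AV_prob_union _) _; rewrite big_bool/= -addrA; apply: lerD.
  apply: le_trans (AV_prob_union _) _; rewrite big_bool/=.
  rewrite -mulrA [X in _ <= X]mulr_natl mulr2n.
  have /= hT := AV_prob_trmx (fun M => exists j, 4 * K < (common_ones [set j] M)%:R).
  have h : AV_prob K (fun M => exists i, 4 * K < (common_ones [set i] M)%:R)
      <= N%:R * expR (- K).
    apply: le_trans (AV_prob_union _) _.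
    apply: le_trans (ler_sum _ (fun i _ => up1 i)) _.
    by rewrite sumr_const card_ord mulr_natl.
  by apply: lerD; rewrite ?hT.
apply: le_trans (AV_prob_union _) _; rewrite big_bool/=; apply: lerD.
  apply: le_trans (AV_prob_union _) _.
  apply: (@le_trans _ _ (\sum_(i < N) expR (- (K / 4)))).
    apply: ler_sum => i _; apply: le_trans (AV_common_ones_lower _ _) _.
    by rewrite cards1 Np1 ler_expR; lra.
  by rewrite sumr_const card_ord mulr_natl.
apply: le_trans (AV_prob_union _) _.
apply: (@le_trans _ _ (\sum_(ik : 'I_N * 'I_N) expR (3 * (K ^+ 2 / N%:R) - L))).
  (* Diagonal pairs yield the empty event, so all N^2 pairs may be summed. *)
  apply: ler_sum => -[i k] _ /=; have [->|ik] := eqVneq i k.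
    apply: le_trans (AV_prob_mono (F := fun=> False) _) _; first by move=> M [].
    by rewrite AV_probE big_pred0 ?expR_ge0// => M; rewrite asboolF.
  apply: le_trans (AV_prob_mono (F := fun M => L < (common_ones [set i; k] M)%:R) _) _.
    by move=> M [].
  by apply: le_trans (AV_common_ones_upper _ _) _; rewrite cards2 ik Np2.
by rewrite sumr_const card_prod card_ord -[X in X <= _]mulr_natl natrM expr2.
Qed.

End RandomMatrix.

(** * Query complexity of balanced matrices *)

Section Solvability.
Variables (R : realType) (n m t h : nat) (S : {set oracle n}) (r q : R).
Let N : R := (2 ^ n)%:R.

(** Here [r] bounds from below the chance that a sample is a one of [f], and [q] bounds from above
    the weight of a wrong [g]: shared ones weigh at most (2t + 1)^2/N each, the others at most
    1/N. *)
Lemma solvable_OIP : (0 < t)%N -> 0 < q -> q <= 1 -> #|S|%:R <= N ->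
  (forall f, f \in S -> oracle_density R f * t%:R ^+ 2 <= 16^-1) ->
  (forall f, f \in S -> r <= oracle_density R f * t.+1%:R ^+ 2) ->
  (forall f g, f \in S -> g \in S -> g != f ->
     #|[set x | f x && g x]|%:R * (2 * t%:R + 1) ^+ 2 + #|[set x | g x]|%:R <= q * N) ->
  2 ^+ h * (1 - r / 2) ^+ m.+1 + N * (q ^+ h * 2 ^+ m.+1) <= 3^-1 ->
  exists A : qalgorithm R n (m.+1 * t), solves_OIP A S.
Proof.
move=> t0 q0 q1 SN up low sep err.
exists (run_algorithm R t (hit_decode S h)) => f fS; rewrite output_prob_run//.
have -> : (2 / 3 : R[i]) = (2 / 3 : R)%:C%C by rewrite rmorphM fmorphV !rmorph_nat.
have N0 : 0 < N by rewrite ltr0n expn_gt0.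
have p0 : 0 <= oracle_density R f by rewrite divr_ge0.
have [A1 A2 B1 B2] := grover_amp_bounds p0 (up f fS).
have A0 : 0 <= (grover_amp (oracle_density R f) t).1.
  by apply: le_trans A1; rewrite ler0n.
(* From t >= 1, the loss 2 p t (t + 1) is at most 4 p t^2 <= 1/4. The sign is needed to square the
   bound [B2]. *)
have B0 : 0 <= (grover_amp (oracle_density R f) t).2.
  apply: le_trans B1; have := up f fS; have : 1 <= t%:R :> R by rewrite ler1n.
  move: (t%:R : R) => x x1 hx.
  have : oracle_density R f * x <= oracle_density R f * x ^+ 2.
    by rewrite ler_wpM2l// expr2 ler_peMl//; lra.
  have -> : 2 * oracle_density R f * x * (x + 1) =
     2 * (oracle_density R f * x ^+ 2) + 2 * (oracle_density R f * x) by ring.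
  lra.
rewrite lecR; apply: le_trans; last first.
  apply: (@hit_decode_success _ _ m.+1 S h (fun x => grover_state R f t x ^+ 2)
            _ _ f r q) => //.
  - by move=> x; exact: sqr_ge0.
  - exact: sum_sqr_grover_state.
  - apply: le_trans (low f fS) _.
    under eq_bigr => x fx do rewrite sqr_grover_state fx.
    rewrite sumr_const (_ : #|[pred x | f x]| = #|[set x | f x]|); last first.
      by apply: eq_card => x; rewrite !inE.
    rewrite -[X in _ <= X]mulr_natr -[X in _ <= X]mulrA [N^-1 * _]mulrC.
    rewrite [X in _ <= X]mulrC ler_wpM2l// lerXn2r// nnegrE// ler0n.
  - move=> g gS gf; have := sep _ _ fS gS gf; rewrite -ler_pdivrMr//; apply: le_trans.
    under eq_bigr do rewrite sqr_grover_state.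
    rewrite -mulr_suml ler_wpM2r ?invr_ge0 ?(ltW N0)//.
    rewrite -!sum1_card !natr_sum mulr_suml [X in X <= _]big_mkcond.
    rewrite [X in _ <= X + _]big_mkcond [X in _ <= _ + X]big_mkcond -big_split/=.
    apply: ler_sum => x _; rewrite !inE; case: (f x); case: (g x);
      rewrite /= ?addr0 ?add0r//.
      by rewrite mul1r -[X in X <= _]addr0 lerD ?ler01// lerXn2r ?nnegrE//; lra.
    by rewrite expr_le1.
have : #|S|%:R * (q ^+ h * 2 ^+ m.+1) <= N * (q ^+ h * 2 ^+ m.+1).
  by rewrite ler_wpM2r// mulr_ge0// exprn_ge0// ltW.
move: err; set e1 := 2 ^+ h * _; set e2 := N * _; set e3 := _ * _; lra.
Qed.

End Solvability.

(** * Both bounds for a fixed balanced matrix *)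

Section BalancedMatrix.
Variables (R : realType) (n : nat) (K L X : R) (M : 'M[bool]_(2 ^ n)).
Let N : R := (2 ^ n)%:R.
Hypothesis MB : balanced K L M.
Hypothesis K_gt0 : 0 < K.
Hypothesis X_ge8 : 8 <= X.
Hypothesis LX : L * X <= K.
Hypothesis KX : K * X ^+ 2 <= N.

Definition row_oracle (i : 'I_(2 ^ n)) : oracle n := [ffun j => M i j].

Lemma row_oraclesP f : reflect (exists i, f = row_oracle i) (f \in row_oracles M).
Proof. by apply: (iffP imsetP) => [[i _ ->]|[i ->]]; exists i. Qed.

Lemma common_ones1 i : common_ones [set i] M = #|[set x | row_oracle i x]|.
Proof.
apply: eq_card => x; rewrite !inE ffunE; apply/forallP/idP => [/(_ i)|Mx k].
  by rewrite inE eqxx.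
by apply/implyP; rewrite inE => /eqP ->.
Qed.

Lemma common_ones2 i k : common_ones [set i; k] M =
  #|[set x | row_oracle i x && row_oracle k x]|.
Proof.
apply: eq_card => x; rewrite !inE !ffunE; apply/forallP/andP => [Mx|[Mi Mk] l].
  by split; [have := Mx i | have := Mx k]; rewrite !inE eqxx ?orbT.
by apply/implyP; rewrite !inE => /orP[]/eqP ->.
Qed.

(** Equal rows would overlap in a full row of at least K/4 ones, whereas L <= K/8. *)
Lemma row_oracle_inj : injective row_oracle.
Proof.
move=> i k e; apply/eqP/negPn/negP => ik; case: MB => _ lo _ /(_ _ _ ik).
have -> : common_ones [set i; k] M = common_ones [set i] M.
  by rewrite common_ones1 common_ones2 -e; apply: eq_card => x; rewrite !inE andbb.
move=> hL; have h := le_trans (lo i) hL.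
have K0 := K_gt0; have LX' := LX.
have h8 : L * 8 <= L * X by rewrite ler_wpM2l//; lra.
by clear e; lra.
Qed.

Lemma card_row_oracles : #|row_oracles M| = (2 ^ n)%N.
Proof. by rewrite (card_imset _ row_oracle_inj) card_ord. Qed.

Lemma card_row_oracles_at x :
  (#|[set f in row_oracles M | f x]|)%:R <= 4 * K.
Proof.
case: MB => /(_ x)/(le_trans _) + _ _ _; apply; rewrite ler_nat.
apply: leq_trans (leq_imset_card row_oracle _); apply: subset_leq_card.
apply/fintype.subsetP => f; rewrite inE => /andP[/row_oraclesP[i ->]].
rewrite ffunE => Mix.
apply: imset_f; rewrite inE; apply/forallP => k; apply/implyP.
by rewrite inE => /eqP ->; rewrite mxE.
Qed.

Let s := Num.sqrt (N / K).

Let N_gt0 : 0 < N. Proof. by rewrite ltr0n expn_gt0. Qed.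

Let s_ge0 : 0 <= s. Proof. exact: sqrtr_ge0. Qed.

Let Ks : K * s ^+ 2 = N.
Proof. by rewrite sqr_sqrtr ?divr_ge0 ?ltW// mulrC divfK// gt_eqF. Qed.

Let sX : X <= s.
Proof.
rewrite -(@ler_pXn2r _ 2) ?nnegrE//; last exact: le_trans X_ge8.
by rewrite -(ler_pM2l K_gt0) Ks.
Qed.

(** With c = 4 K and 2 <= N/3 the hybrid bound gives N/96 <= K q^2, and 96 < 100. *)
Lemma balanced_lower_bound q (A : qalgorithm R n q) : 6 <= N ->
  solves_OIP A (row_oracles M) -> 10^-1 * s <= q%:R.
Proof.
move=> N6 /(query_lower_bound card_row_oracles_at); rewrite card_row_oracles -/N => hq.
rewrite -(@ler_pXn2r _ 2) ?nnegrE ?mulr_ge0//.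
rewrite -(ler_pM2l K_gt0) exprMn mulrCA Ks; lra.
Qed.

Lemma balanced_upper_bound m h :
  2 ^+ h * (1 - 256^-1 / 2) ^+ m.+1 <= 6^-1 :> R ->
  N * ((5 / X) ^+ h * 2 ^+ m.+1) <= 6^-1 ->
  exists2 t, (t%:R <= m.+1%:R / 8 * s) &
    exists A : qalgorithm R n t, solves_OIP A (row_oracles M).
Proof.
move=> e1 e2; have X8 := X_ge8; have Xs := sX; have X0 : 0 < X by lra.
(* The density is between K/(4N) and 4K/N, so t near s/8 puts density times t^2 below 4/64 = 1/16
   and keeps density times (t + 1)^2 above 1/256. *)
pose t := Num.truncn (s / 8).
have /andP[t1 t2] : t%:R <= s / 8 < t.+1%:R.
  by apply: truncn_itv; rewrite divr_ge0.
have t0 : (0 < t)%N.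
  by rewrite -ltnS -(ltr_nat R); apply: le_lt_trans t2; lra.
have t0' : 0 <= t%:R :> R by rewrite ler0n.
exists (m.+1 * t)%N.
  by rewrite natrM -mulrA ler_wpM2l// mulrC.
have N0 : N != 0 by rewrite gt_eqF.
have ts : t%:R ^+ 2 <= s ^+ 2 / 64 :> R.
  by apply: (@le_trans _ _ ((s / 8) ^+ 2)); [rewrite lerXn2r ?nnegrE//; lra | lra].
have ts' : s ^+ 2 / 64 <= t.+1%:R ^+ 2 :> R.
  by apply: (@le_trans _ _ ((s / 8) ^+ 2)); [lra | rewrite lerXn2r ?nnegrE//; lra].
have ts2 : (2 * t%:R + 1) ^+ 2 <= s ^+ 2 :> R by rewrite lerXn2r ?nnegrE//; lra.
case: MB => _ lo hi both.
apply: (@solvable_OIP _ _ _ _ h _ 256^-1 (5 / X)) => //.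
- by rewrite divr_gt0.
- by rewrite ler_pdivrMr//; lra.
- by rewrite card_row_oracles.
- move=> _ /row_oraclesP[i ->]; rewrite /oracle_density -common_ones1 -/N.
  rewrite mulrAC ler_pdivrMr// -Ks.
  apply: (@le_trans _ _ (4 * K * (s ^+ 2 / 64))); last by lra.
  by rewrite ler_pM// ?ler0n// sqr_ge0.
- move=> _ /row_oraclesP[i ->]; rewrite /oracle_density -common_ones1 -/N.
  rewrite mulrAC ler_pdivlMr// -Ks.
  apply: (@le_trans _ _ (K / 4 * (s ^+ 2 / 64))); first by lra.
  by rewrite ler_pM// ?divr_ge0 ?sqr_ge0// ltW.
- move=> _ _ /row_oraclesP[i ->] /row_oraclesP[k ->] ki.
  have ik : i != k by apply: contra_neq ki => ->.
  rewrite -common_ones1 -common_ones2 -/N.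
  apply: (@le_trans _ _ (L * s ^+ 2 + 4 * K)).
    apply: lerD; last exact: hi.
    by rewrite ler_pM// ?sqr_ge0//; exact: both.
  (* One N/X pays for L s^2, as L <= K/X; the other four pay for 4 K, as K X <= N. *)
  have -> : 5 / X * N = N / X + 4 * (N / X) by ring.
  apply: lerD.
    rewrite ler_pdivlMr// mulrAC -Ks; apply: ler_wpM2r; [exact: sqr_ge0 | exact: LX].
  rewrite ler_wpM2l// ler_pdivlMr//; apply: le_trans KX.
  rewrite ler_wpM2l ?(ltW K_gt0)//.
  by rewrite expr2 ler_peMl; lra.
- lra.
Qed.

Lemma balanced_query_complexity m h : 6 <= N ->
  2 ^+ h * (1 - 256^-1 / 2) ^+ m.+1 <= 6^-1 :> R ->
  N * ((5 / X) ^+ h * 2 ^+ m.+1) <= 6^-1 ->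
  exists q, is_query_complexity R (row_oracles M) q /\
    10^-1 * s <= q%:R <= m.+1%:R / 8 * s.
Proof.
move=> N6 e1 e2; have [t ts hA] := balanced_upper_bound e1 e2.
pose P t := `[< exists A : qalgorithm R n t, solves_OIP A (row_oracles M) >].
have exP : exists t, P t by exists t; apply/asboolP.
exists (ex_minn exP); case: ex_minnP => q /asboolP hq minq.
split; first by split=> // u hu; apply: minq; exact/asboolP.
apply/andP; split; first by case: hq => A; exact: balanced_lower_bound.
by apply: le_trans ts; rewrite ler_nat; apply: minq; exact/asboolP.
Qed.

End BalancedMatrix.

(** * Random matrices are balanced *)

Local Open Scope classical_set_scope.

Lemma expRN_le (R : realType) (x : R) (k : nat) : 0 < x ->
  expR (- x) <= (k.+1%:R / x) ^+ k.+1.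
Proof.
move=> x0; have k0 : 0 < k.+1%:R :> R by rewrite ltr0n.
rewrite -[k.+1%:R / x]invrK exprVn expRN.
rewrite lef_pV2 ?posrE ?expR_gt0 ?exprn_gt0 ?invr_gt0 ?divr_gt0//.
rewrite invf_div (_ : expR x = expR (x / k.+1%:R) ^+ k.+1); last first.
  by rewrite -expRM_natl mulrC divfK// gt_eqF.
rewrite lerXn2r ?nnegrE ?expR_ge0 ?divr_ge0 ?(ltW x0)//.
by apply: le_trans (expR_ge1Dx _); rewrite lerDr.
Qed.

Lemma exp_small (R : realType) (z e : R) : 0 <= z -> z < 1 -> 0 < e ->
  exists m, z ^+ m.+1 <= e.
Proof.
move=> z0 z1 e0; have zn : `|z| < 1 by rewrite ger0_norm.
have [k _ hk] := cvgr0_norm_le _ (cvg_expr zn) _ e0.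
by exists k; have := hk k.+1 (leqnSn k); rewrite /= normrX ger0_norm.
Qed.

(** * Powers of N and the limit *)

Section Asymptotics.
Variables (R : realType) (alpha d : R).
Hypothesis d_gt0 : 0 < d.
Hypothesis d_alpha : 2 * d <= alpha.
Hypothesis d_1alpha : 2 * d <= 1 - alpha.

Let N n : R := (2 ^ n)%:R.
Let K n := N n `^ alpha.
(** The two bounds on [d] leave room for a factor X^2 on either side of K: X^2 <= K and K X^2 <=
    N. *)
Let X n := N n `^ d.

Let N_ge1 n : 1 <= N n. Proof. by rewrite ler1n expn_gt0. Qed.
Let N_gt0 n : 0 < N n. Proof. exact: lt_le_trans (N_ge1 n). Qed.
Let K_gt0 n : 0 < K n. Proof. exact: powR_gt0. Qed.
Let X_gt0 n : 0 < X n. Proof. exact: powR_gt0. Qed.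

Let X_exp n k : X n ^+ k = N n `^ (d * k%:R).
Proof. by rewrite powRrM powR_mulrn ?powR_ge0. Qed.

Let X_sqr_leK n : X n ^+ 2 <= K n.
Proof. by rewrite X_exp ler_powR ?N_ge1// mulrC. Qed.

Let KX_leN n : K n * X n ^+ 2 <= N n.
Proof.
have h1 := d_1alpha; rewrite X_exp -powRD; last by rewrite (gt_eqF (N_gt0 n)) implybT.
by rewrite -[X in _ <= X]powRr1 ?(ltW (N_gt0 n))// ler_powR ?N_ge1//; lra.
Qed.

Let X_leN n : X n <= N n.
Proof.
rewrite -[X in _ <= X]powRr1 ?(ltW (N_gt0 n))// ler_powR ?N_ge1//.
by have := d_gt0; have := d_alpha; have := d_1alpha; lra.
Qed.

Let X_geom n : X n = (2 `^ d) ^+ n.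
Proof. by rewrite /X /N natrX -powR_mulrn// powRAC powR_mulrn// powR_ge0. Qed.

Lemma inv_powR_cvg0 (c : R) : c / X n @[n --> \oo] --> 0.
Proof.
have b1 : 1 < 2 `^ d :> R.
  have : 1 `^ d < 2 `^ d :> R by rewrite gt0_ltr_powR ?nnegrE// ltr1n.
  by rewrite powR1.
rewrite (_ : (fun n => _) = (fun n => c * (2 `^ d)^-1 ^+ n)); last first.
  by apply/funext => n; rewrite X_geom exprVn.
rewrite -[X in _ --> X](mulr0 c); apply: cvgMr; apply: cvg_expr.
by rewrite ger0_norm ?invr_ge0 ?powR_ge0// invf_lt1// (lt_trans ltr01).
Qed.

Lemma near_ge_powR (c : R) : 0 < c -> \forall n \near \oo, c <= X n.
Proof.
move=> c0; have [k _ hk] := cvgr0_norm_le _ (inv_powR_cvg0 c) _ ltr01.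
exists k => // n /hk /=; rewrite ger0_norm; last by rewrite divr_ge0 ?ltW.
by rewrite ler_pdivrMr// mul1r.
Qed.

Variable h : nat.
Hypothesis h_large : 2 <= d * h%:R.

Let N_sqr_leX n : N n ^+ 2 <= X n ^+ h.
Proof. by rewrite X_exp -powR_mulrn ?ler_powR ?N_ge1// ltW. Qed.

(** With L = K/X every exponent is at most - X/4: X <= K/X <= K, and 3 K^2/N <= L/4 by X >= 12.
    There are four error terms, each at most N^2 exp (- X/4). *)
Lemma AV_balanced_asymp n : 12 <= X n ->
  1 - 4 * (4 * h.+1%:R) ^+ h.+1 / X n <=
    AV_prob (K n) (balanced (K n) (K n / X n) (N := (2 ^ n)%N)).
Proof.
move=> X12; have x0 := X_gt0 n; have xk := X_sqr_leK n; have k0 := K_gt0 n.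
have n1 := N_ge1 n; have n0 := N_gt0 n; have kx := KX_leN n.
have KN : K n <= (2 ^ n)%:R.
  by apply: le_trans kx; rewrite ler_peMr ?(ltW k0)// expr_ge1//; lra.
apply: le_trans (AV_balanced _ (ltW k0) KN (K n / X n)); last by rewrite expn_gt0.
rewrite lerD2l lerN2 -/(N n).
have XL : X n <= K n / X n by rewrite ler_pdivlMr// -expr2.
have KL : K n / X n <= K n by rewrite ler_pdivrMr// ler_peMr ?(ltW k0)//; lra.
have K2 : 3 * (K n ^+ 2 / N n) <= K n / X n / 4.
  have : K n ^+ 2 / N n <= K n / X n / X n.
    rewrite ler_pdivrMr// -mulrA -invfM -expr2 mulrAC ler_pdivlMr ?exprn_gt0//.
    by rewrite expr2 -mulrA ler_wpM2l ?(ltW k0).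
  have : K n / X n / X n <= K n / X n / 12.
    by rewrite ler_wpM2l ?divr_ge0 ?(ltW k0) ?(ltW x0)// lef_pV2 ?posrE.
  lra.
have bd (e : R) : e <= - (X n / 4) -> N n ^+ 2 * expR e <= (4 * h.+1%:R) ^+ h.+1 / X n.
  rewrite -ler_expR => he; apply: (@le_trans _ _ (X n ^+ h * expR (- (X n / 4)))).
    by rewrite ler_pM// ?sqr_ge0 ?expR_ge0.
  have x4 : 0 < X n / 4 by rewrite divr_gt0.
  (* The power h + 1 exceeds the exponent in N^2 <= X^h by one, which leaves a constant over X. *)
  apply: (@le_trans _ _ (X n ^+ h * (h.+1%:R / (X n / 4)) ^+ h.+1)).
    by rewrite ler_wpM2l ?exprn_ge0 ?(ltW x0)// expRN_le.
  apply: le_of_eq.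
  rewrite invf_div mulrA [h.+1%:R * 4]mulrC [(_ / _) ^+ _]exprMn exprVn.
  rewrite mulrCA; congr (_ * _); rewrite exprS invfM mulrCA divff ?mulr1//.
  by rewrite expf_neq0 ?gt_eqF.
have b1 := bd (- K n); have b2 := bd (- (K n / 4)).
have b3 := bd (3 * (K n ^+ 2 / N n) - K n / X n).
have NN (e : R) : N n * expR e <= N n ^+ 2 * expR e.
  by rewrite ler_wpM2r ?expR_ge0// expr2 ler_peMl ?(ltW n0).
have c1 := NN (- K n); have c2 := NN (- (K n / 4)).
have {}b1 : N n ^+ 2 * expR (- K n) <= (4 * h.+1%:R) ^+ h.+1 / X n by apply: b1; lra.
have {}b2 : N n ^+ 2 * expR (- (K n / 4)) <= (4 * h.+1%:R) ^+ h.+1 / X n.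
  by apply: b2; lra.
have {}b3 : N n ^+ 2 * expR (3 * (K n ^+ 2 / N n) - K n / X n)
  <= (4 * h.+1%:R) ^+ h.+1 / X n by apply: b3; lra.
rewrite -[4 * _ * _]mulrA; move: b1 b2 b3 c1 c2.
set e1 := expR (- K n); set e2 := expR (- (K n / 4)); set e3 := expR (_ - _).
lra.
Qed.

Lemma AV_query_complexity_asymp n m :
  2 ^+ h * (1 - 256^-1 / 2) ^+ m.+1 <= 6^-1 :> R ->
  12 <= X n -> 6 * (5 ^+ h * 2 ^+ m.+1) <= X n ->
  1 - 4 * (4 * h.+1%:R) ^+ h.+1 / X n <=
  AV_prob (K n) (fun M : 'M[bool]_(2 ^ n) =>
    exists q : nat, is_query_complexity R (row_oracles M) q /\
      10^-1 * Num.sqrt (N n / K n) <= q%:R <= m.+1%:R / 8 * Num.sqrt (N n / K n)) <= 1.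
Proof.
move=> e1 X12 Xm; have x0 := X_gt0 n; have n0 := N_gt0 n.
have KN : K n <= (2 ^ n)%:R.
  by apply: le_trans (KX_leN n); rewrite ler_peMr ?(ltW (K_gt0 n))// expr_ge1//; lra.
have N0 : (0 < 2 ^ n)%N by rewrite expn_gt0.
have K0 := ltW (K_gt0 n).
apply/andP; split; last by rewrite -(AV_probT (2 ^ n)%N (K n)); exact: AV_prob_mono.
apply: le_trans (AV_balanced_asymp X12) _; apply: AV_prob_mono => // M MB.
apply: (@balanced_query_complexity _ _ _ _ (X n) _ MB _ _ _ _ m h) => //.
- by lra.
- by rewrite divfK// gt_eqF.
- by apply: le_trans (X_leN n); lra.
rewrite expr_div_n -/(N n) mulrAC mulrA.
rewrite ler_pdivrMr ?exprn_gt0//.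
(* X^h >= N^2 absorbs the union bound over N rows with a factor N to spare, which beats the constant
   5^h 2^(m+1). *)
apply: (@le_trans _ _ (6^-1 * N n ^+ 2)); last by rewrite ler_wpM2l.
rewrite expr2 [X in _ <= X]mulrCA ler_wpM2l ?(ltW n0)//.
by have := X_leN n; lra.
Qed.

End Asymptotics.

Theorem theorem5 (R : realType) (alpha : R) (halpha0 : 0 < alpha)
    (halpha1 : alpha < 1) :
  exists c C : R, 0 < c /\ 0 < C /\
    (fun n : nat =>
       let N := (2 ^ n)%N in
       let K := N%:R `^ alpha in
       AV_prob K (fun M : 'M[bool]_N =>
         exists q : nat, is_query_complexity R (row_oracles M) q /\
           c * Num.sqrt (N%:R / K) <= q%:R <= C * Num.sqrt (N%:R / K)))
      @ \oo --> (1 : R).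
Proof.
have [d d0 [da d1a]] : exists2 d, 0 < d & 2 * d <= alpha /\ 2 * d <= 1 - alpha.
  (* Then 2 d is the product of alpha and 1 - alpha, hence below both. *)
  by exists (alpha * (1 - alpha) / 2); [nra | split; nra].
pose h := (Num.truncn (2 / d)).+1.
have hd : 2 <= d * h%:R.
  by rewrite mulrC -ler_pdivrMr//; apply/ltW/truncnS_gt.
(* The threshold [h] depends on [d] only and [m] is chosen after it, so both constants depend on
   alpha alone. *)
have [m hm] : exists m, (1 - 256^-1 / 2 : R) ^+ m.+1 <= 6^-1 / 2 ^+ h.
  by apply: exp_small; [lra | lra | rewrite divr_gt0 ?invr_gt0 ?exprn_gt0].
exists 10^-1, (m.+1%:R / 8); split; first by rewrite invr_gt0.
split; first by rewrite divr_gt0.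
have hm' : 2 ^+ h * (1 - 256^-1 / 2) ^+ m.+1 <= 6^-1 :> R.
  by rewrite mulrC -ler_pdivlMr ?exprn_gt0.
pose X n : R := (2 ^ n)%:R `^ d.
apply: (@squeeze_cvgr _ _ _ _ (fun n => 1 - 4 * (4 * h.+1%:R) ^+ h.+1 / X n) (cst 1)).
- have X12 := near_ge_powR d0 (ltr0n R 12).
  have Xm : \forall n \near \oo, 6 * (5 ^+ h * 2 ^+ m.+1) <= X n.
    by apply: near_ge_powR => //; rewrite !mulr_gt0 ?exprn_gt0.
  near=> n; apply: AV_query_complexity_asymp d0 da d1a _ hd _ _ hm' _ _.
    by near: n.
  by near: n.
- rewrite -[X in _ --> X]subr0; apply: cvgB; first exact: cvg_cst.
  exact: inv_powR_cvg0.
- exact: cvg_cst.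
Unshelve. all: by end_near.
Qed.
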